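(* Let $(\tilde A_b,\tilde A_w)$ be a fuzzy pairwise comparison system having its comparison values from the linguistic scale. Let $F=\{\alpha_1,\alpha_2,\dots,\alpha_k\}\subset[0,1]$ be such that $0=\alpha_1<\alpha_2<\dots<\alpha_k=1$. Let $\eta^{t*}$ be the optimal objective value of the model $\mathrm{LP}([0,1])$ and let $\eta_F^{t*}$ be the optimal objective value of the model $\mathrm{LP}(F)$, both associated with $(\tilde A_b,\tilde A_w)$. Then there exists a positive constant $M$ such that $$|\eta^{t*}-\eta_F^{t*}|\le M\,\|F\|_\infty .$$
   Context: A Triangular Fuzzy Number (TFN) is a triple of reals $(l,m,u)$ with $l\le m\le u$. Its Graded Mean Integration Representation is $R(l,m,u)=\frac{l+4m+u}{6}$. Linguistic scale of TFNs: $\tilde 1=(1,1,1)$, $\tilde 2=(1,2,3)$, $\tilde 3=(2,3,4)$, $\tilde 4=(3,4,5)$, $\tilde 5=(4,5,6)$, $\tilde 6=(5,6,7)$, $\tilde 7=(6,7,8)$, $\tilde 8=(7,8,9)$, $\tilde 9=(9,9,9)$. Fuzzy pairwise comparison system (FPCS): there are $n$ criteria indexed by $\{1,\dots,n\}$, with two distinct distinguished indices $b$ (best) and $w$ (worst). The FPCS consists of the vectors $\tilde A_b=(\tilde a_{b1},\dots,\tilde a_{bn})$ (Best-to-Others) and $\tilde A_w=(\tilde a_{1w},\dots,\tilde a_{nw})$ (Others-to-Worst), where each $\tilde a_{ij}=(a_{ij}^l,a_{ij}^m,a_{ij}^u)$ is a TFN, and the entry $\tilde a_{bw}$ is common to both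 vectors. For $\alpha\in[0,1]$ put $a_{ij}^l(\alpha)=a_{ij}^l+\alpha(a_{ij}^m-a_{ij}^l)$ and $a_{ij}^u(\alpha)=a_{ij}^u-\alpha(a_{ij}^u-a_{ij}^m)$. For a set $S\subseteq[0,1]$, the model $\mathrm{LP}(S)$ is: the variables are $\tilde w_q=(w_q^l,w_q^m,w_q^u)\in\mathbb{R}^3$ for $q=1,\dots,n$, and $\eta\in\mathbb{R}$. Minimize $\eta$ subject to: for all $i\in\{1,\dots,n\}\setminus\{b,w\}$ and all $\alpha\in S$, $$\left|w_b^l+\alpha(w_b^m-w_b^l)-a_{bi}^l(\alpha)\,(w_i^u-\alpha(w_i^u-w_i^m))\right|\le\eta,$$ $$\left|w_i^l+\alpha(w_i^m-w_i^l)-a_{iw}^l(\alpha)\,(w_w^u-\alpha(w_w^u-w_w^m))\right|\le\eta,$$ $$\left|w_b^l+\alpha(w_b^m-w_b^l)-a_{bw}^l(\alpha)\,(w_w^u-\alpha(w_w^u-w_w^m))\right|\le\eta,$$ $$\left|w_b^u-\alpha(w_b^u-w_b^m)-a_{bi}^u(\alpha)\,(w_i^l+\alpha(w_i^m-w_i^l))\right|\le\eta,$$ $$\left|w_i^u-\alpha(w_i^u-w_i^m)-a_{iw}^u(\alpha)\,(w_w^l+\alpha(w_w^m-w_w^l))\right|\le\eta,$$ $$\left|w_b^u-\alpha(w_b^u-w_b^m)-a_{bw}^u(\alpha)\,(w_w^l+\alpha(w_w^m-w_w^l))\right|\le\eta,$$ together with $0\le w_q^l\le w_q^m\le w_q^u$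 for all $q\in\{1,\dots,n\}$ and $\sum_{i=1}^n R(\tilde w_i)=1$. (The third and sixth constraints do not involve $i$ and are imposed for all $\alpha\in S$.) The mesh of $F=\{\alpha_1<\dots<\alpha_k\}$ is $\|F\|_\infty=\max\{\alpha_{i+1}-\alpha_i\mid i=1,\dots,k-1\}$. *)

(* Defs.v *)
From HB Require Import structures.
From mathcomp Require Import all_boot all_order all_algebra.
From mathcomp Require Import all_classical all_reals.
Set Implicit Arguments.
Unset Strict Implicit.
Unset Printing Implicit Defensive.
Import Order.TTheory GRing.Theory Num.Theory.
Local Open Scope classical_set_scope.
Local Open Scope ring_scope.

(* A triple (l, m, u) of reals, not necessarily ordered. *)
Definition triple (R : realType) : Type := (R * R * R)%type.

Definition lo (R : realType) (t : triple R) : R := t.1.1.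
Definition md (R : realType) (t : triple R) : R := t.1.2.
Definition up (R : realType) (t : triple R) : R := t.2.

Definition is_tfn (R : realType) (t : triple R) : Prop :=
  lo t <= md t /\ md t <= up t.

(* Graded Mean Integration Representation. *)
Definition gmir (R : realType) (t : triple R) : R :=
  (lo t + 4 * md t + up t) / 6.

(* Endpoints of the alpha-cut of a triangular fuzzy number. *)
Definition lcut (R : realType) (t : triple R) (alpha : R) : R :=
  lo t + alpha * (md t - lo t).
Definition ucut (R : realType) (t : triple R) (alpha : R) : R :=
  up t - alpha * (up t - md t).

(* The end of the scale is the crisp (9, 9, 9), not (8, 9, 10). *)
Definition linguistic_scale (R : realType) : seq (R * R * R) :=
  [:: (1, 1, 1); (1, 2, 3); (2, 3, 4); (3, 4, 5); (4, 5, 6);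
      (5, 6, 7); (6, 7, 8); (7, 8, 9); (9, 9, 9)].

(* Fuzzy pairwise comparison system on the criteria 'I_n: [best_to A i] is
   the comparison a_{b i} and [to_worst A i] is the comparison a_{i w}. *)
Record fpcs (R : realType) (n : nat) := FPCS {
  best : 'I_n;
  worst : 'I_n;
  best_neq_worst : best != worst;
  best_to : 'I_n -> triple R;
  to_worst : 'I_n -> triple R;
  best_to_tfn : forall i, is_tfn (best_to i);
  to_worst_tfn : forall i, is_tfn (to_worst i);
  best_to_worst : best_to worst = to_worst best }.

Definition scale_valued (R : realType) (n : nat) (A : fpcs R n) : Prop :=
  forall i, best_to A i \in linguistic_scale R /\
            to_worst A i \in linguistic_scale R.

Definition lp_feasible (R : realType) (n : nat) (A : fpcs R n) (S : set R)
    (w : 'I_n -> triple R) (eta : R) : Prop :=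
  let b := best A in
  let v := worst A in
  [/\ forall i alpha, i != b -> i != v -> S alpha ->
        [/\ `|lcut (w b) alpha
               - lcut (best_to A i) alpha * ucut (w i) alpha| <= eta,
            `|lcut (w i) alpha
               - lcut (to_worst A i) alpha * ucut (w v) alpha| <= eta,
            `|ucut (w b) alpha
               - ucut (best_to A i) alpha * lcut (w i) alpha| <= eta
          & `|ucut (w i) alpha
               - ucut (to_worst A i) alpha * lcut (w v) alpha| <= eta],
      forall alpha, S alpha ->
        `|lcut (w b) alpha
           - lcut (best_to A v) alpha * ucut (w v) alpha| <= eta /\
        `|ucut (w b) alpha
           - ucut (best_to A v) alpha * lcut (w v) alpha| <= eta,
      forall q, [/\ 0 <= lo (w q), lo (w q) <= md (w q)
                  & md (w q) <= up (w q)]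
    & \sum_(i < n) gmir (w i) = 1].

(* For S a nonempty subset of [0, 1], the set of feasible objective values is
   nonempty and bounded below by 0, so [inf] is not a default value here. *)
Definition lp_value (R : realType) (n : nat) (A : fpcs R n) (S : set R) : R :=
  inf [set eta : R | exists w : 'I_n -> triple R, lp_feasible A S w eta].

(* F lists alpha_1 < ... < alpha_k in order. *)
Definition is_grid (R : realType) (F : seq R) : Prop :=
  [/\ {subset F <= `[0, 1]}, sorted <%R F, F`_0 = 0 & last 0 F = 1].

(* The neutral element 0 is harmless: all gaps of an increasing list are
   positive. *)
Definition mesh (R : realType) (F : seq R) : R :=
  \big[Num.max/0]_(i < (size F).-1) (F`_i.+1 - F`_i).

(* Main.v *)
Require Import Defs.
From HB Require Import structures.
From mathcomp Require Import all_boot all_order all_algebra.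
From mathcomp Require Import all_classical all_reals.
From mathcomp Require Import lra.
Set Implicit Arguments.
Unset Strict Implicit.
Unset Printing Implicit Defensive.
Import Order.TTheory GRing.Theory Num.Theory.
Local Open Scope classical_set_scope.
Local Open Scope ring_scope.

(** Every constraint of the model bounds, at each level alpha in S, a residual
    [x(alpha) - a(alpha) * y(alpha)], where x and y are endpoints of cuts of
    weights and a is an endpoint of a cut of a comparison. The normalisation
    of the weights confines them to [0, 6], and the linguistic scale confines
    the comparisons to [0, 9]; cut endpoints are affine in alpha, so all the
    residuals are Lipschitz in alpha with a constant L that depends neither
    on the weights nor on S ([lp_feasible_approx]).

    Therefore, if every level of T is within delta of a level of S, weights
    that are feasible for S with objective eta are feasible for T with
    objective [eta + L * delta], and the optimal values satisfy
    [lp_value A T <= lp_value A S + L * delta] ([lp_value_approx]). Every level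
    in [0, 1] is within the mesh of a grid point ([grid_approx]), and grid
    points are themselves levels in [0, 1], so this applies in both directions
    between [0, 1] and the grid. *)

Section NonnegativeTriples.

Variable R : realType.
Implicit Types (t : triple R) (C alpha beta delta : R).

Definition tfn_within C t : Prop :=
  [/\ 0 <= lo t, lo t <= md t, md t <= up t & up t <= C].

Lemma lcut_within C t alpha :
  tfn_within C t -> 0 <= alpha <= 1 -> 0 <= lcut t alpha <= C.
Proof. by case=> ? ? ? ? /andP[? ?]; rewrite /lcut; apply/andP; split; nra. Qed.

Lemma ucut_within C t alpha :
  tfn_within C t -> 0 <= alpha <= 1 -> 0 <= ucut t alpha <= C.
Proof. by case=> ? ? ? ? /andP[? ?]; rewrite /ucut; apply/andP; split; nra. Qed.

Lemma lcut_lipschitz C t alpha beta : tfn_within C t ->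
  `|lcut t alpha - lcut t beta| <= C * `|alpha - beta|.
Proof.
move=> [? ? ? ?].
have -> : lcut t alpha - lcut t beta = (md t - lo t) * (alpha - beta).
  by rewrite /lcut; lra.
by rewrite normrM ler_wpM2r // ger0_norm; lra.
Qed.

Lemma ucut_lipschitz C t alpha beta : tfn_within C t ->
  `|ucut t alpha - ucut t beta| <= C * `|alpha - beta|.
Proof.
move=> [? ? ? ?].
have -> : ucut t alpha - ucut t beta = - ((up t - md t) * (alpha - beta)).
  by rewrite /ucut; lra.
by rewrite normrN normrM ler_wpM2r // ger0_norm; lra.
Qed.

(** Splitting [a * y - a' * y'] as [a * (y - y') + (a - a') * y'] gives the two
    terms [C * B * delta]. *)
Lemma residual_approx B C delta (x x' a a' y y' : R) :
  0 <= a <= C -> 0 <= y' <= B ->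
  `|x - x'| <= B * delta -> `|a - a'| <= C * delta -> `|y - y'| <= B * delta ->
  `|x - a * y| <= `|x' - a' * y'| + (B + 2 * C * B) * delta.
Proof.
move=> /andP[a0 aC] /andP[y0 yB] dx da dy.
have -> : x - a * y = (x' - a' * y') + ((x - x') - a * (y - y') - (a - a') * y').
  by lra.
apply: le_trans (ler_normD _ _) _; rewrite lerD2l.
apply: le_trans (ler_normB _ _) _.
have := ler_normB (x - x') (a * (y - y')).
rewrite !normrM (ger0_norm a0) (ger0_norm y0) => h.
have h1 : a * `|y - y'| <= C * (B * delta) by apply: ler_pM.
have h2 : `|a - a'| * y' <= (C * delta) * B by apply: ler_pM.
by lra.
Qed.

Lemma residual_bounded B C (x a y : R) :
  0 <= x <= B -> 0 <= a <= C -> 0 <= y <= B -> `|x - a * y| <= B + C * B.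
Proof.
move=> /andP[x0 xB] /andP[a0 aC] /andP[y0 yB].
have h : a * y <= C * B by apply: ler_pM.
have h0 : 0 <= a * y by apply: mulr_ge0.
by rewrite ler_norml; apply/andP; split; lra.
Qed.

(** The two Lipschitz estimates needed for a pair of opposite constraints: lower
    endpoints against an upper one, and upper endpoints against a lower one. *)
Lemma cut_residual_approx B C delta (tx ta ty : triple R) alpha beta :
  tfn_within B tx -> tfn_within C ta -> tfn_within B ty ->
  0 <= alpha <= 1 -> 0 <= beta <= 1 -> `|alpha - beta| <= delta ->
  `|lcut tx alpha - lcut ta alpha * ucut ty alpha|
    <= `|lcut tx beta - lcut ta beta * ucut ty beta| + (B + 2 * C * B) * delta
  /\
  `|ucut tx alpha - ucut ta alpha * lcut ty alpha|
    <= `|ucut tx beta - ucut ta beta * lcut ty beta| + (B + 2 * C * B) * delta.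
Proof.
move=> Bx Ca By a01 b01 ab.
have B0 : 0 <= B by case: Bx => ? ? ? ?; lra.
have C0 : 0 <= C by case: Ca => ? ? ? ?; lra.
have lcutP D t : 0 <= D -> tfn_within D t ->
    `|lcut t alpha - lcut t beta| <= D * delta.
  move=> D0 tD; apply: le_trans (lcut_lipschitz alpha beta tD) _.
  exact: ler_wpM2l.
have ucutP D t : 0 <= D -> tfn_within D t ->
    `|ucut t alpha - ucut t beta| <= D * delta.
  move=> D0 tD; apply: le_trans (ucut_lipschitz alpha beta tD) _.
  exact: ler_wpM2l.
split; apply: residual_approx;
  by [apply: lcut_within | apply: ucut_within | apply: lcutP | apply: ucutP].
Qed.

End NonnegativeTriples.

Lemma linguistic_scale_within (R : realType) (t : triple R) :
  t \in linguistic_scale R -> tfn_within 9 t.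
Proof.
rewrite /linguistic_scale !inE.
by do ![case/orP] => /eqP->; split; rewrite /lo /md /up /=; lra.
Qed.

(** A single nonnegative fuzzy weight has GMIR at most the total 1, and the
    upper end contributes one sixth of it. *)
Lemma normalised_weights_within (R : realType) (n : nat) (w : 'I_n -> triple R) :
  (forall q, [/\ 0 <= lo (w q), lo (w q) <= md (w q) & md (w q) <= up (w q)]) ->
  \sum_(i < n) gmir (w i) = 1 -> forall q, tfn_within 6 (w q).
Proof.
move=> wP sum1 q.
have gmir_ge0 i : 0 <= gmir (w i) by have [? ? ?] := wP i; rewrite /gmir; lra.
have : gmir (w q) <= 1.
  by rewrite -sum1 (bigD1 q) //= lerDl; apply: sumr_ge0.
by have [? ? ?] := wP q; rewrite /gmir => ?; split; lra.
Qed.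

Section Approximation.

Variables (R : realType) (n : nat) (A : fpcs R n).
Implicit Types (S T : set R) (C eta delta : R) (w : 'I_n -> triple R).

Definition comparisons_within C : Prop :=
  forall i, tfn_within C (best_to A i) /\ tfn_within C (to_worst A i).

Definition covered_within delta T S : Prop :=
  forall alpha, T alpha -> exists2 beta, S beta & `|alpha - beta| <= delta.

Lemma lp_feasible_approx C S T delta w eta :
  comparisons_within C -> S `<=` `[0, 1] -> T `<=` `[0, 1] ->
  covered_within delta T S -> lp_feasible A S w eta ->
  lp_feasible A T w (eta + (6 + 2 * C * 6) * delta).
Proof.
move=> AC S01 T01 cover [feas_i feas_bw wP sum1].
have w6 := normalised_weights_within wP sum1.
have in01 (U : set R) alpha : U `<=` `[0, 1] -> U alpha -> 0 <= alpha <= 1.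
  by move=> U01 /U01; rewrite /= in_itv.
split=> //.
- move=> i alpha ib iv Ta; have [beta Sb ab] := cover _ Ta.
  have [h1 h2 h3 h4] := feas_i i beta ib iv Sb.
  have [Cb Cw] := AC i.
  have [k1 k3] := cut_residual_approx (w6 (best A)) Cb (w6 i)
                    (in01 _ _ T01 Ta) (in01 _ _ S01 Sb) ab.
  have [k2 k4] := cut_residual_approx (w6 i) Cw (w6 (worst A))
                    (in01 _ _ T01 Ta) (in01 _ _ S01 Sb) ab.
  by split; [apply: le_trans k1 _ | apply: le_trans k2 _
            |apply: le_trans k3 _ | apply: le_trans k4 _]; rewrite lerD2r.
- move=> alpha Ta; have [beta Sb ab] := cover _ Ta.
  have [h1 h2] := feas_bw beta Sb.
  have [Cb _] := AC (worst A).
  have [k1 k2] := cut_residual_approx (w6 (best A)) Cb (w6 (worst A))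
                    (in01 _ _ T01 Ta) (in01 _ _ S01 Sb) ab.
  by split; [apply: le_trans k1 _ | apply: le_trans k2 _]; rewrite lerD2r.
Qed.

(** The equal crisp weights 1/n satisfy the normalisation, and the residuals of
    normalised weights are bounded. *)
Lemma lp_feasible_exists C S : comparisons_within C -> S `<=` `[0, 1] ->
  exists w eta, lp_feasible A S w eta.
Proof.
move=> AC S01.
have n0 : (0 < n)%N by case: n (best A) => [[]|].
pose w (q : 'I_n) : triple R := (n%:R^-1, n%:R^-1, n%:R^-1).
have ninv_ge0 : 0 <= n%:R^-1 :> R by rewrite invr_ge0.
have wP q : [/\ 0 <= lo (w q), lo (w q) <= md (w q) & md (w q) <= up (w q)].
  by rewrite /lo /md /up /=.
have sum1 : \sum_(i < n) gmir (w i) = 1.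
  have gmirE i : gmir (w i) = n%:R^-1 by rewrite /gmir /lo /md /up /=; lra.
  rewrite (eq_bigr (fun=> n%:R^-1)) // sumr_const card_ord -[_ *+ n]mulr_natr mulVf //.
  by rewrite pnatr_eq0 -lt0n.
have w6 := normalised_weights_within wP sum1.
exists w, (6 + C * 6); split=> //.
- move=> i alpha _ _ /S01; rewrite /= in_itv /= => a01; have [Cb Cw] := AC i.
  by split; apply: residual_bounded; do ?[exact: lcut_within | exact: ucut_within].
- move=> alpha /S01; rewrite /= in_itv /= => a01; have [Cb _] := AC (worst A).
  by split; apply: residual_bounded; do ?[exact: lcut_within | exact: ucut_within].
Qed.

(** [T !=set0] makes the objective for T bounded below: without any level there
    is no constraint on eta. *)
Lemma lp_value_approx C S T delta :
  comparisons_within C -> S `<=` `[0, 1] -> T `<=` `[0, 1] -> T !=set0 ->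
  covered_within delta T S ->
  lp_value A T <= lp_value A S + (6 + 2 * C * 6) * delta.
Proof.
move=> AC S01 T01 [alpha Ta] cover.
rewrite -lerBlDr; apply: lb_le_inf.
  by have [w [eta feas]] := lp_feasible_exists AC S01; exists eta, w.
move=> eta [w feas]; rewrite lerBlDr; apply: ge_inf.
  exists 0 => e [w' [_ feas_bw _ _]].
  by have [h _] := feas_bw alpha Ta; apply: le_trans h.
by exists w; apply: lp_feasible_approx feas.
Qed.

End Approximation.

Section Grid.

Variable R : realType.

Lemma mesh_ge_gap (F : seq R) (i : nat) :
  (i.+1 < size F)%N -> F`_i.+1 - F`_i <= mesh F.
Proof.
move=> iF; have iF' : (i < (size F).-1)%N by rewrite -ltnS prednK // (leq_trans _ iF).
by rewrite /mesh (le_bigmax _ (fun j : 'I__ => F`_j.+1 - F`_j) (Ordinal iF')).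
Qed.

Lemma mesh_ge0 (F : seq R) : 0 <= mesh F.
Proof. exact: bigmax_ge_id. Qed.

Lemma grid_approx (F : seq R) : is_grid F ->
  covered_within (mesh F) `[0, 1]%classic [set` F].
Proof.
move=> [_ _ F0 F1] alpha; rewrite /= in_itv /= => /andP[a0 a1].
have last_in : last 0 F \in F.
  by case: F F0 F1 => [|x s] _ /= e1; [move: e1; lra | rewrite mem_last].
have hasF : has (fun x => alpha <= x) F.
  by apply/hasP; exists (last 0 F); rewrite // F1.
(* The first grid point that is not below alpha. *)
pose i := find (fun x => alpha <= x) F.
have iF : (i < size F)%N by rewrite -has_find.
have a_le : alpha <= F`_i := nth_find 0 hasF.
exists F`_i; first exact: mem_nth.
case def_i: i a_le iF => [|j] a_le jF.
  have -> : alpha = 0 by move: a_le; rewrite F0; lra.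
  by rewrite F0 subrr normr0 mesh_ge0.
have a_gt : F`_j < alpha.
  by rewrite ltNge (@before_find _ 0 (fun x => alpha <= x) F) // -/i def_i.
rewrite distrC ger0_norm ?subr_ge0 //.
by apply: le_trans (mesh_ge_gap jF); rewrite lerD2l lerN2 ltW.
Qed.

End Grid.

Theorem theorem2 (R : realType) (n : nat) (A : fpcs R n)
    (hA : scale_valued A) :
  exists M : R, 0 < M /\
    forall F : seq R, is_grid F ->
      `|lp_value A `[0, 1]%classic - lp_value A [set` F]| <= M * mesh F.
Proof.
have AC : comparisons_within A 9.
  by move=> i; have [? ?] := hA i; split; apply: linguistic_scale_within.
exists (6 + 2 * 9 * 6); split; first by lra.
move=> F gridF.
have FS01 : [set` F] `<=` `[0, 1] by case: gridF => subF _ _ _ x /subF.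
have zero01 : `[0, 1]%classic (0 : R) by rewrite /= in_itv /=; lra.
have cover := grid_approx gridF.
have F_neq0 : [set` F] !=set0 by have [x Fx _] := cover 0 zero01; exists x.
have cover' : covered_within (mesh F) [set` F] `[0, 1]%classic.
  by move=> x Fx; exists x; [exact: FS01 | rewrite subrr normr0 mesh_ge0].
have le1 := lp_value_approx AC FS01 (@subset_refl _ _) (ex_intro _ _ zero01) cover.
have le2 := lp_value_approx AC (@subset_refl _ _) FS01 F_neq0 cover'.
by rewrite ler_norml; apply/andP; split; lra.
Qed.
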